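(* For any swap dynamics $M\in\mathcal{M}_2$, the price of anarchy $\mathit{PoA}_{ark}(M)$ with respect to the average rank is $2$ in the single-peaked domain.
   Context: Housing market: an instance is $I=\langle \mathcal{N},\mathcal{R},L,\pi^0\rangle$ with $\mathcal{N}=\{a_1,\dots,a_n\}$ a set of $n$ agents, $\mathcal{R}=\{r_1,\dots,r_n\}$ a set of $n$ resources, $L$ a profile of strict linear orders $\succ_i$ over $\mathcal{R}$, one for each agent $a_i$, and $\pi^0$ an initial allocation; an allocation $\pi$ is a bijective assignment of one resource $\pi_{a_i}$ to each agent $a_i$. The instance is single-peaked if there is a linear order $\lhd$ over $\mathcal{R}$ such that for every agent $a_i$ with top resource $t_i$ and all resources $r,r'$, if $r'\lhd r\lhd t_i$ or $t_i\lhd r\lhd r'$ then $r\succ_i r'$. Ranks: $rank_{a_i}(r)\in\{1,\dots,n\}$ is such that $a_i$'s most preferred resource has rank $n$, the second most preferred $n-1$, ..., the least preferred $1$. The average rank is $ark(\pi)=\frac1n\sum_{a_i\in\mathcal{N}}rank_{a_i}(\pi_{a_i})$. Swap dynamics: a swap-deal between two distinct agents exchanges the resources they currently hold; it is improving if both strictly prefer the resource they receive. A swap dynamics is determined by a selection heuristic, which at each round proposes a swap-deal (a pair of agents), possibly depending on the history and on the preferences, possibly randomly. Starting from $\pi^0$, the proposed deal is implemented (successful) if it is improving and refused otherwise. The heuristic has full coverage if for any two agents $a_x,a_y$ the deal $\langle a_x,a_y\rangle$ is proposed at some round, and, if there are successful swap-deals involving $a_x$ or $a_y$, at some round after the latest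 one. The process terminates when every pair $a_x,a_y$ has been unsuccessfully proposed at a round after which no successful deal involved $a_x$ or $a_y$; thus the final allocation is reached from $\pi^0$ by improving swap-deals and admits no improving swap-deal. $\mathcal{M}_2$ is the family of swap dynamics whose selection heuristic has full coverage. $M(I)$ is the set of allocations that $M$ may return on $I$. Price of anarchy (the worst-case ratio, over all instances, between the social welfare optimum and the worst stable outcome): $\mathit{PoA}_{v}(M)=\max_{I}\dfrac{\max_{\pi} v(\pi)}{\min_{\pi\in M(I)}v(\pi)}$, here with $v=ark$, where $I$ ranges over the instances of the domain considered (here, the single-peaked instances) and, in the numerator, $\pi$ ranges over all allocations of $I$.
   Formalization: The maximum over instances in the definition of the price of anarchy is read as a supremum: with n agents every single-peaked instance has ratio at most 2n/(n+1) < 2, so the value 2 is approached as n grows but never attained. *)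

(* Defs.v *)
From HB Require Import structures.
From mathcomp Require Export all_boot all_order all_algebra all_fingroup.
From mathcomp Require Export all_classical all_reals all_analysis.

Set Implicit Arguments.
Unset Strict Implicit.
Unset Printing Implicit Defensive.

Import Order.TTheory GRing.Theory Num.Theory.

Local Open Scope classical_set_scope.
Local Open Scope ring_scope.

Definition strict_linear_order (T : eqType) (r : rel T) : Prop :=
  [/\ irreflexive r, transitive r & forall x y, x != y -> r x y || r y x].

(* Agents and resources are both indexed by 'I_n; an allocation sends each
   agent to the resource it holds. *)
Definition allocation (n : nat) := {perm 'I_n}.

Record instance (n : nat) := Instance {
  pref : 'I_n -> rel 'I_n;  (* [pref i r r'] : agent i strictly prefers r to r' *)
  prefP : forall i, strict_linear_order (pref i);
  init : allocation n }.

Definition is_top n (I : instance n) (i t : 'I_n) : Prop :=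
  forall r, r != t -> pref I i t r.

Definition single_peaked n (I : instance n) : Prop :=
  exists2 lhd : rel 'I_n, strict_linear_order lhd &
    forall i t r r', is_top I i t ->
      (lhd r' r && lhd r t) || (lhd t r && lhd r r') -> pref I i r r'.

Definition rank n (I : instance n) (i r : 'I_n) : nat :=
  #|[set r' | pref I i r r']%SET|.+1.

Definition ark (R : realType) n (I : instance n) (pi : allocation n) : R :=
  n%:R^-1 * \sum_(i < n) (rank I i (pi i))%:R.

(* A deal (x, y) is read as the unordered pair <x, y>. A diagonal pair (x, x)
   is never improving and never counts as one of the deals to be covered: it
   stands for a round without proposal, which is unavoidable when there is only
   one agent. *)
Definition deal (n : nat) := ('I_n * 'I_n)%type.

Definition is_deal n (dl : deal n) (x y : 'I_n) : bool :=
  (dl == (x, y)) || (dl == (y, x)).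

Definition involves n (dl : deal n) (x : 'I_n) : bool :=
  (dl.1 == x) || (dl.2 == x).

Definition improving n (I : instance n) (pi : allocation n) (dl : deal n) : bool :=
  pref I dl.1 (pi dl.2) (pi dl.1) && pref I dl.2 (pi dl.1) (pi dl.2).

Definition swap n (pi : allocation n) (dl : deal n) : allocation n :=
  (tperm dl.1 dl.2 * pi)%g.

Definition step n (I : instance n) (pi : allocation n) (dl : deal n) :
    allocation n :=
  if improving I pi dl then swap pi dl else pi.

Definition alloc_after n (I : instance n) (h : seq (deal n)) : allocation n :=
  foldl (step I) (init I) h.

(* The selection heuristic: the deal proposed at a round is a function of the
   instance, of the history and of a random seed, drawn once according to [law]
   (a seed may be an infinite sequence of independent draws, or trivial for a
   deterministic heuristic). A history is the list of the past proposals, oldest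
   first; which of them succeeded is determined by the instance.
   Instances have n.+1 agents, since the set of agents is nonempty. *)
Record swap_dynamics (R : realType) := SwapDynamics {
  seed_display : measure_display;
  seed : measurableType seed_display;
  law : probability seed R;
  propose : forall n, instance n.+1 -> seq (deal n.+1) -> seed -> deal n.+1;
  measurable_propose : forall n (I : instance n.+1) h dl,
    measurable [set w | propose I h w = dl] }.

Section Run.
Variables (R : realType) (M : swap_dynamics R).
Variables (n : nat) (I : instance n.+1) (w : seed M).

Fixpoint history (t : nat) : seq (deal n.+1) :=
  if t is s.+1 then rcons (history s) (propose I (history s) w) else [::].

Definition proposal (t : nat) : deal n.+1 := propose I (history t) w.

Definition alloc_at (t : nat) : allocation n.+1 := alloc_after I (history t).

Definition successful (t : nat) : bool := improving I (alloc_at t) (proposal t).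

Definition success_involving (x y : 'I_n.+1) (t : nat) : bool :=
  successful t && (involves (proposal t) x || involves (proposal t) y).

Definition covers : Prop :=
  forall x y, x != y ->
    exists2 t, is_deal (proposal t) x y &
      forall s, success_involving x y s -> (s < t)%N.

(* The process has terminated once rounds 0, ..., t-1 have been played. *)
Definition terminated (t : nat) : Prop :=
  forall x y, x != y ->
    exists2 s, (s < t)%N &
      [/\ is_deal (proposal s) x y, ~~ successful s &
        forall u, (s < u < t)%N -> ~~ success_involving x y u].

Definition returns (pi : allocation n.+1) : Prop :=
  exists2 t, terminated t & alloc_at t = pi.

End Run.

(* Full coverage of a randomized heuristic is required almost surely. *)
Definition M2 (R : realType) (M : swap_dynamics R) : Prop :=
  forall n (I : instance n.+1), {ae law M, forall w, covers I w}.

(* The allocations that the dynamics returns with positive probability. *)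
Definition outcomes (R : realType) (M : swap_dynamics R) n (I : instance n.+1) :
    set (allocation n.+1) :=
  [set pi | (0 < law M [set w | returns I w pi])%E].

Section PriceOfAnarchy.
Variables (R : realType) (v : forall n, instance n -> allocation n -> R).

(* The sets of values are finite, so [sup] and [inf] are a maximum and a minimum
   (the outcomes are nonempty for dynamics in M2). *)
Definition anarchy_ratio (M : swap_dynamics R) n (I : instance n.+1) : R :=
  sup [set v I pi | pi in [set: allocation n.+1]] /
  inf [set v I pi | pi in outcomes M I].

(* The worst case over all instances of a domain D, of all sizes, is a
   supremum: it need not be attained. *)
Definition PoA (D : forall n, instance n -> Prop) (M : swap_dynamics R) : \bar R :=
  ereal_sup [set x | exists n (I : instance n.+1),
    D n.+1 I /\ x = (anarchy_ratio M I)%:E].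

End PriceOfAnarchy.

(* Main.v *)
(* Upper bound: in a stable allocation of a single-peaked instance, every set of
   agents contains one who holds its favourite among the resources held in the
   set. Removing such agents one by one shows that the ranks are at least
   n, n-1, ..., 1 in some order, so ark is at least (n+1)/2, whereas it never
   exceeds n.
   Lower bound: in the instance [cascade] the initial allocation is stable, with
   ranks exactly n, n-1, ..., 1, although shifting every resource by one gives
   its top resource to every agent but one; the ratio tends to 2. *)
Require Import Defs.
From mathcomp Require Import zify ring lra.

Set Implicit Arguments.
Unset Strict Implicit.
Unset Printing Implicit Defensive.

Import Order.TTheory GRing.Theory Num.Theory.

Local Open Scope ring_scope.

(** * Ranks in stable allocations of single-peaked instances *)

Definition stable n (I : instance n) (pi : allocation n) : Prop :=
  forall x y, x != y -> ~~ improving I pi (x, y).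

(** Counting predecessors turns the order into a comparison of naturals, so that extremal elements
    can be picked by [arg min] and [arg max]. *)
Lemma strict_linear_order_pos (T : finType) (r : rel T) : strict_linear_order r ->
  exists pos : T -> nat, forall x y, r x y = (pos x < pos y)%N.
Proof.
move=> hr; have [rirr rtr rtot] := hr.
exists (fun x => #|[set z | r z x]%SET|) => x y.
have mono a b : r a b -> (#|[set z | r z a]%SET| < #|[set z | r z b]%SET|)%N.
  move=> ab; apply/proper_card/properP; split.
    by apply/fintype.subsetP => z; rewrite !inE => za; exact: rtr za ab.
  by exists a; rewrite !inE ?rirr.
apply/idP/idP; first exact: mono.
case: (eqVneq x y) => [->|xy]; first by rewrite ltnn.
case/orP: (rtot _ _ xy) => // yx /ltnW.
by rewrite leqNgt mono.
Qed.

Section SinglePeaked.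
Variables (n : nat) (I : instance n).

Lemma prefN i r r' : r != r' -> ~~ pref I i r r' -> pref I i r' r.
Proof. by case: (prefP I i) => _ _ tot rr' /negPf h; have := tot _ _ rr'; rewrite h. Qed.

Lemma top_exists (i r0 : 'I_n) : exists t, is_top I i t.
Proof.
have [pos posE] := strict_linear_order_pos (prefP I i).
exists [arg min_(t < r0) pos t]; case: arg_minnP => // t _ tmin r rt.
apply: prefN => //; by rewrite posE -leqNgt tmin.
Qed.

(** Unless [b] is the top itself, the top lies on one side of [b], and [b] beats its neighbour on
    the other side. *)
Lemma single_peaked_no_valley (lhd : rel 'I_n) :
  strict_linear_order lhd ->
  (forall i t r r', is_top I i t ->
      (lhd r' r && lhd r t) || (lhd t r && lhd r r') -> pref I i r r') ->
  forall i a b c, lhd a b -> lhd b c -> pref I i b a || pref I i b c.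
Proof.
move=> [irr _ tot] sp i a b c ab bc; have [t top] := top_exists i a.
have [bt|bt] := eqVneq b t.
  by rewrite bt in ab *; rewrite top //; apply: contraTneq ab => ->; rewrite irr.
case/orP: (tot _ _ bt) => h.
  by rewrite (sp i t b a) // ab h.
by rewrite (sp i t b c) ?orbT // bc h orbT.
Qed.

(* An agent of S not holding its favourite among the resources held in S wants
   to move in exactly one direction along the axis. The leftmost one wants to
   move right and the rightmost one left, so two consecutive ones want to move
   towards each other; by single-peakedness they want each other's resource. *)
Lemma stable_satisfied_agent (pi : allocation n) (S : {set 'I_n}) :
  single_peaked I -> stable I pi -> S != finset.set0 ->
  exists2 i, i \in S & forall j, j \in S -> j != i -> pref I i (pi i) (pi j).
Proof.
move=> [lhd slo sp] st /set0Pn[i0 i0S].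
have nv := single_peaked_no_valley slo sp.
have [pos posE] := strict_linear_order_pos slo; have [_ _ tot] := slo.
have lhd_neq i j : lhd (pi i) (pi j) -> i != j.
  by apply: contraTneq => ->; rewrite posE ltnn.
pose moves_right i := [exists j in S, lhd (pi i) (pi j) && pref I i (pi j) (pi i)].
have [/existsP[i /andP[iS /forall_inP iP]]|] :=
  boolP [exists i in S, [forall j in S, (j != i) ==> pref I i (pi i) (pi j)]].
  by exists i => // j jS; apply/implyP/iP.
move=> /existsPn none.
have wants i : i \in S -> exists2 j, j \in S & (j != i) && pref I i (pi j) (pi i).
  move=> iS; have := none i; rewrite iS /= => /forall_inPn[j jS].
  rewrite negb_imply => /andP[ji nij]; exists j => //; rewrite ji /=.
  by apply: prefN => //; rewrite (inj_eq perm_inj) eq_sym.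
pose l := [arg min_(i < i0 in S) pos (pi i)].
have [lS lR] : l \in S /\ moves_right l.
  rewrite /l; case: arg_minnP => // i iS imin; split=> //.
  have [j jS /andP[ji ij]] := wants _ iS.
  apply/existsP; exists j; rewrite jS ij andbT /=.
  have := tot (pi i) (pi j); rewrite (inj_eq perm_inj) eq_sym ji => /(_ isT).
  by case/orP => //; rewrite posE ltnNge imin.
(* [x] is the right-mover holding the rightmost resource, and [y] the member of [S] holding the next
   resource after that of [x]; by the choice of [x], [y] is not a right-mover. *)
have lP : (l \in S) && moves_right l by rewrite lS.
case: (@arg_maxnP _ l [pred i | (i \in S) && moves_right i]
  (fun i => pos (pi i)) lP) => /= x /andP[xS xR] xmax.
have /existsP[c /andP[cS /andP[xc prc]]] := xR.
have cP : (c \in S) && lhd (pi x) (pi c) by rewrite cS.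
case: (@arg_minnP _ c [pred j | (j \in S) && lhd (pi x) (pi j)]
  (fun i => pos (pi i)) cP) => /= y /andP[yS xy] ymin.
have nyR : ~~ moves_right y.
  apply/negP => yR; have := xmax y; rewrite yS yR => /(_ isT).
  by rewrite leqNgt -posE xy.
(* [pi y] lies between [pi x] and some [pi c] that [x] prefers to [pi x], so a valley at [pi y] is
   excluded. *)
have prxy : pref I x (pi y) (pi x).
  have [->//|yc] := eqVneq y c.
  have yltc : lhd (pi y) (pi c).
    have := tot (pi y) (pi c); rewrite (inj_eq perm_inj) yc => /(_ isT).
    by case/orP => //; rewrite posE ltnNge ymin.
  case/orP: (nv x _ _ _ xy yltc) => // h.
  by case: (prefP I x) => _ tr _; exact: tr h prc.
have [j jS /andP[jy prj]] := wants _ yS.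
have jlty : lhd (pi j) (pi y).
  have := tot (pi j) (pi y); rewrite (inj_eq perm_inj) jy => /(_ isT).
  case/orP => // yj; case/negP: nyR; apply/existsP; exists j.
  by rewrite jS yj prj.
have pryx : pref I y (pi x) (pi y).
  have [<-//|jx] := eqVneq j x.
  (* No member of [S] holds a resource strictly between those of [x] and [y]. *)
  have jltx : lhd (pi j) (pi x).
    have := tot (pi j) (pi x); rewrite (inj_eq perm_inj) jx => /(_ isT).
    case/orP => // xj; have := ymin j; rewrite jS xj => /(_ isT).
    by rewrite leqNgt -posE jlty.
  case/orP: (nv y _ _ _ jltx xy) => // h.
    by case: (prefP I y) => _ tr _; exact: tr h prj.
by have := st x y (lhd_neq _ _ xy); rewrite /improving /= prxy pryx.
Qed.

Lemma stable_sum_rank (pi : allocation n) : single_peaked I -> stable I pi ->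
  (n * n.+1 <= 2 * \sum_(i < n) rank I i (pi i))%N.
Proof.
move=> sp st.
(* Stability concerns the whole allocation, so it stays available as [S] shrinks; the factor 2
   avoids division in the triangular sum. *)
suff H (S : {set 'I_n}) : (#|S| * #|S|.+1 <= 2 * \sum_(i in S) rank I i (pi i))%N.
  have := H finset.setT; rewrite cardsT card_ord.
  by rewrite (eq_bigl predT) // => i; rewrite inE.
have [k kS] := ubnP #|S|; elim: k S kS => // k IH S kS.
have [->|S0] := eqVneq S finset.set0; first by rewrite cards0.
have [i iS iP] := stable_satisfied_agent sp st S0.
have cS := cardsD1 i S; rewrite iS in cS.
have {}IH := IH (S :\ i)%SET ltac:(lia); rewrite (big_setD1 i iS) /=.
(* The satisfied agent places the [#|S| - 1] resources held by the rest of [S] below its own. *)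
have rk : (#|S| <= rank I i (pi i))%N.
  rewrite cS ltnS -(card_imset (mem (S :\ i)%SET) (@perm_inj _ pi)).
  apply/subset_leq_card/fintype.subsetP => r /imsetP[j].
  by rewrite !inE => /andP[ji jS] ->; exact: iP.
move: IH rk; rewrite cS add1n.
move: (\sum_(j in (S :\ i)%SET) rank I j (pi j))%N (rank I i (pi i)) #|_| => s r c.
nia.
Qed.

Lemma rank_le (i r : 'I_n) : (rank I i r <= n)%N.
Proof.
apply: (@leq_trans #|[set~ r]%SET|.+1); last first.
  by rewrite cardsC1 card_ord; have := ltn_ord r; lia.
rewrite ltnS; apply/subset_leq_card/fintype.subsetP => r'; rewrite !inE.
by apply: contraTneq => ->; case: (prefP I i) => ->.
Qed.

End SinglePeaked.

(** * Termination, measurability and outcomes of the dynamics *)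

Section Dynamics.
Variables (R : realType) (M : swap_dynamics R) (n : nat) (I : instance n.+1).

Lemma alloc_atS (w : seed M) t :
  alloc_at I w t.+1 = step I (alloc_at I w t) (proposal I w t).
Proof. by rewrite /alloc_at /alloc_after foldl_rcons. Qed.

Lemma improvingC (pi : allocation n.+1) x y :
  improving I pi (x, y) = improving I pi (y, x).
Proof. by rewrite /improving /= andbC. Qed.

Lemma alloc_at_frame (w : seed M) x s t : (s <= t)%N ->
  (forall u, (s <= u < t)%N ->
     ~~ (successful I w u && involves (proposal I w u) x)) ->
  alloc_at I w t x = alloc_at I w s x.
Proof.
move=> /subnKC <-; elim: (t - s)%N => [|k IH] H; first by rewrite addn0.
rewrite addnS alloc_atS /step -/(successful I w (s + k)).
have <- : alloc_at I w (s + k) x = alloc_at I w s x by apply: IH => u ?; apply: H; lia.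
case: ifP => // suc; have := H (s + k)%N; rewrite suc /involves negb_or.
move=> /(_ ltac:(lia)) /andP[d1 d2].
by rewrite /swap permM tpermD.
Qed.

(** For each pair, the last refusal shows that the swap was not improving then, and neither agent
    has traded since. *)
Lemma terminated_stable (w : seed M) t :
  terminated I w t -> stable I (alloc_at I w t).
Proof.
move=> tm x y xy; have [s st [dl ns nu]] := tm x y xy.
have frame z : (z == x) || (z == y) -> alloc_at I w t z = alloc_at I w s z.
  move=> zxy; apply: alloc_at_frame; first exact: ltnW.
  (* Termination only constrains the rounds after [s]; round [s] itself changes nothing because its
     deal was refused. *)
  move=> u /andP[]; rewrite leq_eqVlt => /predU1P[<-|su] ut.
    by rewrite (negPf ns).
  have := nu u; rewrite su ut => /(_ isT); apply: contra => /andP[suc inv].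
  by rewrite /success_involving suc; case/orP: zxy inv => /eqP <- ->; rewrite ?orbT.
have -> : improving I (alloc_at I w t) (x, y) = improving I (alloc_at I w s) (x, y).
  by rewrite /improving /= !frame ?eqxx ?orbT.
by move: ns; rewrite /successful; case/orP: dl => /eqP -> //; rewrite improvingC.
Qed.

(** There are finitely many pairs, so one round comes after all their covering proposals. *)
Lemma covers_terminated (w : seed M) : covers I w -> exists t, terminated I w t.
Proof.
move=> cov.
have /choice[f fP] (p : 'I_n.+1 * 'I_n.+1) : exists t, p.1 != p.2 ->
    is_deal (proposal I w t) p.1 p.2 /\
    forall s, success_involving I w p.1 p.2 s -> (s < t)%N.
  have [e|/cov[t ? ?]] := eqVneq p.1 p.2; first by exists 0%N.
  by exists t.
exists (\max_p f p).+1 => x y xy; have [dl last] := fP (x, y) xy.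
exists (f (x, y)); first by rewrite ltnS; exact: leq_bigmax.
split=> // [|u /andP[fu _]].
(* A success at the covering round would itself involve [x] and [y], hence have to precede that
   round. *)
- apply/negP => suc; suff : (f (x, y) < f (x, y))%N by rewrite ltnn.
  apply: last; rewrite /success_involving suc /involves /=.
  by case/orP: dl => /eqP ->; rewrite /= eqxx ?orbT.
- by apply/negP => /last /=; rewrite ltnNge ltnW.
Qed.

Local Open Scope classical_set_scope.

Lemma measurable_history t h : measurable [set w : seed M | history I w t = h].
Proof.
elim: t h => [|t IH] h /=.
  have [->|h0] := eqVneq h [::].
    by rewrite (_ : [set _ | _] = setT) //; apply/seteqP; split.
  rewrite (_ : [set _ | _] = set0) //; apply/seteqP; split=> // w /= e.
  by rewrite e eqxx in h0.
case/lastP: h => [|h d].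
  rewrite (_ : [set _ | _] = set0) //; apply/seteqP; split=> // w /= e.
  by have := size_rcons (history I w t) (propose I (history I w t) w); rewrite e.
rewrite (_ : [set _ | _] =
    [set w | history I w t = h] `&` [set w | propose I h w = d]).
  by apply: measurableI => //; exact: measurable_propose.
apply/seteqP; split=> w /=; first by move=> /rcons_inj[-> <-].
by move=> [-> ->].
Qed.

Lemma history_prefix (w w' : seed M) t : history I w t = history I w' t ->
  forall s, (s <= t)%N -> history I w s = history I w' s.
Proof.
elim: t => [|t IH] e s; first by rewrite leqn0 => /eqP ->.
rewrite leq_eqVlt => /predU1P[->//|]; rewrite ltnS; apply: IH.
by case/rcons_inj: e.
Qed.

Lemma history_proposal (w w' : seed M) t : history I w t = history I w' t ->
  forall s, (s < t)%N -> proposal I w s = proposal I w' s.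
Proof. by move=> /history_prefix e s /e /rcons_inj[]. Qed.

(** Termination at [t] depends on the seed only through the history up to [t]; this reduces the
    event of returning [pi] to history events. *)
Lemma terminated_history (w w' : seed M) t : history I w t = history I w' t ->
  terminated I w t -> terminated I w' t.
Proof.
move=> e tm x y xy; have [s st [dl ns nu]] := tm x y xy.
have esuc u : (u < t)%N -> successful I w' u = successful I w u.
  move=> ut; rewrite /successful /alloc_at (history_prefix e (ltnW ut)).
  by rewrite (history_proposal e ut).
exists s => //; split=> [||u sut].
- by rewrite -(history_proposal e st).
- by rewrite esuc.
- have ut : (u < t)%N by case/andP: sut.
  by have := nu u sut; rewrite /success_involving esuc // (history_proposal e ut).
Qed.

(** The event is a union, over rounds and over the countably many histories, of measurable history
    events. *)
Lemma measurable_returns pi : measurable [set w : seed M | returns I w pi].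
Proof.
pose A t := [set w : seed M | terminated I w t /\ alloc_at I w t = pi].
rewrite (_ : [set _ | _] = \bigcup_t A t); last first.
  by apply/seteqP; split=> w /=; [move=> [t]; exists t | move=> [t _ []]; exists t].
apply: bigcup_measurable => t _.
rewrite (_ : A t = \bigcup_(h in [set history I w t | w in A t])
    [set w | history I w t = h]); last first.
  apply/seteqP; split=> w /=; first by move=> Aw; exists (history I w t) => //; exists w.
  move=> [_ [w' [tm al] <-] /= e]; split; first exact: terminated_history tm.
  by rewrite /alloc_at e.
rewrite bigcup_mkcond; apply: countable_bigcupT_measurable => [|h]; first exact: countableP.
by case: ifP => // _; exact: measurable_history.
Qed.

Lemma outcome_stable pi : outcomes M I pi -> stable I pi.
Proof.
move=> pos; have [w [t tm <-]] : [set w : seed M | returns I w pi] !=set0.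
  by apply/set0P/negP => /eqP e; move: pos; rewrite /outcomes /= e measure0 ltxx.
exact: terminated_stable.
Qed.

(** No deal ever succeeds, so every run stays at [init I]; full coverage makes it terminate almost
    surely, so [init I] is returned with probability 1. *)
Lemma stable_init_outcome : M2 M -> stable I (init I) ->
  outcomes M I = [set init I].
Proof.
move=> hM st.
have const (w : seed M) t : alloc_at I w t = init I.
  elim: t => // t IH; rewrite alloc_atS IH /step.
  case: (proposal I w t) => x y; have [->|xy] := eqVneq x y.
    by rewrite /improving /=; case: (prefP I y) => ->.
  by rewrite (negPf (st _ _ xy)).
apply/seteqP; split=> pi; rewrite /outcomes /=.
  move=> pos; have [w [t _ <-]] : [set w : seed M | returns I w pi] !=set0.
    by apply/set0P/negP => /eqP e; move: pos; rewrite e measure0 ltxx.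
  exact: const.
move=> ->; set A := [set w | _].
have mA : measurable A by exact: measurable_returns.
have : law M (~` A) = 0%E.
  apply/negligibleP; first exact: measurableC.
  apply: negligibleS (hM n I) => w /= nA /covers_terminated[t tm].
  by apply: nA; exists t.
rewrite probability_setC // => e; rewrite lt0e measure_ge0 andbT.
by apply/eqP => A0; move: e; rewrite A0 sube0 => /eqP; rewrite onee_eq0.
Qed.

End Dynamics.

(** * The worst-case instances *)

Section WorstCase.
Variable n : nat.

(* Agent i ranks the resources as i-1 > ... > 0 > i > i+1 > ...: its own
   resource i is the best one among i, i+1, ..., whereas i-1 is its favourite. *)
Definition cascade_key (i r : 'I_n.+1) : nat := if (r < i)%N then (i - r).-1 else r.

Definition cascade_pref (i : 'I_n.+1) : rel 'I_n.+1 :=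
  fun r r' => (cascade_key i r < cascade_key i r')%N.

Lemma cascade_prefP i : strict_linear_order (cascade_pref i).
Proof.
split=> [r|r r' r''|r r' rr']; rewrite /cascade_pref; [exact: ltnn|exact: ltn_trans|].
have : (r : nat) != r' by [].
by rewrite -neq_ltn /cascade_key; case: (ltnP r i); case: (ltnP r' i); lia.
Qed.

Definition cascade : instance n.+1 := Instance cascade_prefP 1%g.

Lemma cascade_single_peaked : single_peaked cascade.
Proof.
exists (fun r r' : 'I_n.+1 => (r < r')%N).
  by split=> [r|r r' r''|r r' rr']; [exact: ltnn|exact: ltn_trans|rewrite -neq_ltn].
move=> i t r r' top H.
(* For agent 0 the truncated predecessor is 0, which is indeed its top. *)
have {top} tE : (t : nat) = i.-1.
  have [e|/eqP ne] := eqVneq (t : nat) i.-1; first by [].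
  have lt : (i.-1 < n.+1)%N by have := ltn_ord i; lia.
  have := top (Ordinal lt); rewrite /= /cascade_pref /cascade_key /=.
  have -> : (Ordinal lt != t) by apply/eqP => e; apply: ne; rewrite -e.
  by move=> /(_ isT); case: (ltnP t i); case: (ltnP i.-1 i); lia.
move: H; rewrite /= /cascade_pref /cascade_key tE.
by case: (ltnP r i); case: (ltnP r' i); lia.
Qed.

(** Of two agents, the one with the smaller index prefers its own resource to every later one, so it
    refuses. *)
Lemma cascade_stable : stable cascade (init cascade).
Proof.
move=> x y; rewrite -(inj_eq val_inj) /= => xy.
rewrite /improving /= /cascade_pref /cascade_key !perm1 !ltnn.
by case: (ltnP y x); case: (ltnP x y); lia.
Qed.

Lemma cascade_rank_init i : rank cascade i (init cascade i) = (n.+1 - i)%N.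
Proof.
rewrite /rank /= perm1.
have -> : [set r' | cascade_pref i i r']%SET = (~: [set r : 'I_n.+1 | (r < i.+1)%N])%SET.
  apply/setP => r; rewrite !inE /cascade_pref /cascade_key ltnn.
  by case: (ltnP r i); lia.
rewrite cardsCs finset.setCK card_ord -sum1dep_card (big_ord_narrow (ltn_ord i)).
by rewrite big_const_ord iter_addn_0 mul1n subSS subSn // -ltnS.
Qed.

Lemma cascade_sum_rank_init :
  (2 * \sum_(i < n.+1) rank cascade i (init cascade i) = n.+1 * n.+2)%N.
Proof.
under eq_bigr do rewrite cascade_rank_init.
elim: n.+1 => [|k IH]; first by rewrite big_ord0.
rewrite big_ord_recl /= subn0; under eq_bigr do rewrite /bump subSS.
by rewrite mulnDr IH; lia.
Qed.

(** [ord_pred] is cyclic: agent 0 receives the last resource, its least preferred one. *)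
Definition shift_down : allocation n.+1 := perm (@ord_pred_inj n.+1).

Lemma cascade_rank_shift (i : 'I_n.+1) : i != ord0 ->
  rank cascade i (shift_down i) = n.+1.
Proof.
rewrite -(inj_eq val_inj) /= => i0; rewrite /rank permE.
have e : ord_pred i = i.-1 :> nat.
  have -> : ord_pred i = ((i + n.+1).-1 %% n.+1)%N :> nat by [].
  have -> : (i + n.+1).-1 = (i.-1 + n.+1)%N by lia.
  by rewrite modnDr modn_small //; have := ltn_ord i; lia.
move: (ord_pred i) e => j e.
have -> : [set r' | pref cascade i j r']%SET = [set~ j]%SET.
  apply/setP => r; rewrite !inE -(inj_eq val_inj) /= /cascade_pref /cascade_key e.
  by case: (ltnP r i); case: (ltnP i.-1 i); lia.
by rewrite cardsC1 card_ord.
Qed.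

Lemma cascade_sum_rank_shift :
  (n * n.+1 <= \sum_(i < n.+1) rank cascade i (shift_down i))%N.
Proof.
rewrite big_ord_recl; under eq_bigr do rewrite cascade_rank_shift //.
by rewrite big_const_ord iter_addn_0; lia.
Qed.

End WorstCase.

(** * Bounds on the anarchy ratio *)

Section Ratio.
Variables (R : realType) (M : swap_dynamics R).
Local Open Scope classical_set_scope.

Lemma ark_ub n (I : instance n.+1) pi : ark R I pi <= n.+1%:R.
Proof.
rewrite /ark ler_pdivrMl ?ltr0n // -natr_sum -natrM ler_nat.
rewrite -[X in (_ <= X * _)%N]card_ord -sum_nat_const.
by apply: leq_sum => i _; exact: rank_le.
Qed.

Lemma stable_ark_lb n (I : instance n.+1) pi :
  single_peaked I -> stable I pi -> n.+2%:R / 2 <= ark R I pi.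
Proof.
move=> sp /(stable_sum_rank sp); rewrite -(ler_nat R) !natrM natr_sum => H.
by rewrite /ark ler_pdivlMl ?ltr0n // mulrA ler_pdivrMr ?ltr0n // [leRHS]mulrC.
Qed.

Lemma anarchy_ratio_ub n (I : instance n.+1) : single_peaked I ->
  anarchy_ratio (@ark R) M I <= 2.
Proof.
move=> sp; rewrite /anarchy_ratio; set N := sup _; set D := inf _.
have hN : N <= n.+1%:R.
  by apply: ge_sup; [exists (ark R I (init I)), (init I) | move=> _ [pi _ <-]; exact: ark_ub].
(* If there are no outcomes, the infimum is 0 by convention, and so are its inverse and the
   ratio. *)
have [[pi0 o0]|o0] := pselect (outcomes M I !=set0); last first.
  rewrite /D (_ : [set _ | _ in _] = set0) ?inf0 ?invr0 ?mulr0 //.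
  by apply/seteqP; split=> // r [pi opi _]; apply: o0; exists pi.
have hD : n.+2%:R / 2 <= D.
  apply: lb_le_inf; first by exists (ark R I pi0), pi0.
  by move=> _ [pi /outcome_stable st <-]; exact: stable_ark_lb.
have D0 : 0 < D by apply: lt_le_trans hD; rewrite divr_gt0 ?ltr0n.
rewrite ler_pdivrMr //; move: hN hD; rewrite -[n.+2%:R]natr1.
by move: n.+1%:R N D {D0} => a N D; lra.
Qed.

(** The shifted allocation gives a ratio of at least [2n / (n + 2) = 2 - 4 / (n + 2)], which is
    weakened to a simpler denominator. *)
Lemma anarchy_ratio_cascade n : M2 M ->
  2 - 4 / n.+1%:R <= anarchy_ratio (@ark R) M (cascade n).
Proof.
move=> hM; rewrite /anarchy_ratio (stable_init_outcome hM (@cascade_stable n)).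
rewrite image_set1 inf1.
have -> : ark R (cascade n) (init (cascade n)) = n.+2%:R / 2.
  have := cascade_sum_rank_init n => /(congr1 (fun k => k%:R : R)).
  rewrite !natrM natr_sum /ark => e.
  have n0 : n.+1%:R != 0 :> R by rewrite pnatr_eq0.
  by apply: (mulfI n0); rewrite mulVKf // mulrA -e; field.
have : n%:R <= sup [set ark R (cascade n) pi | pi in [set: allocation n.+1]].
  apply: (@le_trans _ _ (ark R (cascade n) (shift_down n))).
    by rewrite /ark ler_pdivlMl ?ltr0n // -natr_sum -natrM ler_nat mulnC cascade_sum_rank_shift.
  apply: ub_le_sup; last by exists (shift_down n).
  by exists n.+1%:R => _ [pi _ <-]; exact: ark_ub.
set N := sup _ => hN.
rewrite ler_pdivlMr ?divr_gt0 ?ltr0n //; apply: le_trans hN.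
rewrite -subr_ge0 (_ : _ - _ = 2 / n.+1%:R) ?divr_ge0 ?ler0n //.
by rewrite -!natr1; field; rewrite natr1 pnatr_eq0.
Qed.

End Ratio.

Theorem proposition7 (R : realType) (M : swap_dynamics R) (hM : M2 M) :
  PoA (@ark R) single_peaked M = 2%:E.
Proof.
apply/eqP; rewrite eq_le; apply/andP; split.
  apply: ge_ereal_sup => _ [n [I [sp ->]]].
  by rewrite lee_fin; exact: anarchy_ratio_ub.
(* The cascades only approach 2, so the lower bound is proved up to an arbitrary [e > 0]. *)
apply/lee_subgt0Pr => e e0.
have [n hn] : exists n, 4 / n.+1%:R <= e.
  exists (Num.truncn (4 / e)); rewrite ler_pdivrMr ?ltr0n // mulrC -ler_pdivrMr //.
  exact/ltW/truncnS_gt.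
apply: (@le_trans _ _ (anarchy_ratio (@ark R) M (cascade n))%:E).
  rewrite -EFinB lee_fin; apply: le_trans (anarchy_ratio_cascade n hM).
  by rewrite lerB.
apply: ereal_sup_ubound; exists n, (cascade n); split=> //.
exact: cascade_single_peaked.
Qed.
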